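(* Let $t>1$, $f=1$, and let $d$ be an integer with $0\le d\le t$, $d\ne 1$. Then there is no discreet strategy for the parameters $(t,f,d)$.
   Context: There are $t$ distinguishable coins, identified with a set $T$ with $|T|=t$. All real coins weigh the same, all fake coins weigh the same, and a fake coin is lighter than a real one. Exactly $f$ coins are fake; the lawyer knows the true set $F\subset T$ of fake coins, $|F|=f$. The judge only knows in advance that the number of fake coins is either $f$ or $d$ ($d\neq f$, $0\le d\le t$). A weighing places $n\ge 1$ coins on the left pan and $n$ other coins on the right pan of a balance scale; its outcome is one of ''balanced'', ''left pan lighter'', ''right pan lighter'' (the pan with more fake coins is lighter; the pans balance if they contain equally many fake coins). For a finite sequence of weighings performed with true fake set $F$, a set $S\subseteq T$ is consistent if, were $S$ the set of fake coins, every weighing would have the same outcome as it has for $F$. A strategy for $(t,f,d)$ is a choice of $F$ with $|F|=f$ and a finite sequence of weighings that proves to the judge that there are exactly $f$ fake coins, i.e. no set $S$ with $|S|=d$ is consistent. It is discreet if no information about any particular coin is revealed: for every coin $c\in T$ there is a consistent set $S$ with $|S|=f$ and $c\in S$, and also a consistent set $S'$ with $|S'|=f$ and $c\notin S'$. *)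

(* Defs.v *)
From mathcomp Require Import all_boot.

Set Implicit Arguments.
Unset Strict Implicit.
Unset Printing Implicit Defensive.

Record weighing (T : finType) := Weighing {
  left_pan : {set T};
  right_pan : {set T};
  left_pan_gt0 : 0 < #|left_pan|;
  card_pans : #|left_pan| = #|right_pan|;
  disjoint_pans : [disjoint left_pan & right_pan]
}.

Inductive outcome := Balanced | LeftLighter | RightLighter.

(* Fake coins are lighter: the pan with more of them is the lighter one. *)
Definition outcome_of (T : finType) (w : weighing T) (S : {set T}) : outcome :=
  let l := #|left_pan w :&: S| in
  let r := #|right_pan w :&: S| in
  if l == r then Balanced else if r < l then LeftLighter else RightLighter.

Definition consistent (T : finType) (F : {set T}) (ws : seq (weighing T))
    (S : {set T}) : Prop :=
  [seq outcome_of w S | w <- ws] = [seq outcome_of w F | w <- ws].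

(* The number t of coins is #|T|. *)
Definition is_strategy (T : finType) (f d : nat) (F : {set T})
    (ws : seq (weighing T)) : Prop :=
  #|F| = f /\ ~ (exists S : {set T}, #|S| = d /\ consistent F ws S).

Definition discreet (T : finType) (f : nat) (F : {set T})
    (ws : seq (weighing T)) : Prop :=
  forall c : T,
    (exists S : {set T}, [/\ consistent F ws S, #|S| = f & c \in S]) /\
    (exists S : {set T}, [/\ consistent F ws S, #|S| = f & c \notin S]).

(* Main.v *)
Require Import Defs.
From mathcomp Require Import all_boot.

(** When a single coin is fake, a fake-coin set of the same size is determined
    by any one of its elements, so discretion forces every singleton to be
    consistent. But a weighing has a coin on each pan, and it tips one way if
    the left coin is the fake one and the other way if the right coin is:
    [no_weighing_fits_all_singletons]. Hence a discreet strategy performs no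
    weighing at all; then every set is consistent, in particular some set of
    [d] coins, and nothing has been proved to the judge. *)

Lemma cardsI1 (T : finType) (A : {set T}) (c : T) :
  #|A :&: [set c]| = (c \in A).
Proof.
case: (boolP (c \in A)) => cA.
  by rewrite (setIidPr _) ?cards1 ?sub1set.
by apply/eqP; rewrite cards_eq0 setI_eq0 disjoint_sym disjoints1.
Qed.

Lemma outcome_of_left_coin (T : finType) (w : weighing T) (c : T) :
  c \in left_pan w -> outcome_of w [set c] = LeftLighter.
Proof.
move=> cL; have cR := disjointFr (disjoint_pans w) cL.
by rewrite /outcome_of !cardsI1 cL cR.
Qed.

Lemma outcome_of_right_coin (T : finType) (w : weighing T) (c : T) :
  c \in right_pan w -> outcome_of w [set c] = RightLighter.
Proof.
move=> cR; have cL := disjointFl (disjoint_pans w) cR.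
by rewrite /outcome_of !cardsI1 cL cR.
Qed.

(** Comparing a coin of the left pan with a coin of the right pan already rules
    out a common outcome. *)
Lemma no_weighing_fits_all_singletons (T : finType) (w : weighing T)
    (o : outcome) :
  ~ (forall c : T, outcome_of w [set c] = o).
Proof.
move=> same.
have /card_gt0P[l lL] := left_pan_gt0 w.
have /card_gt0P[r rR] : 0 < #|right_pan w|.
  by rewrite -card_pans left_pan_gt0.
by have := same l; rewrite -(same r) outcome_of_left_coin // outcome_of_right_coin.
Qed.

Lemma discreet_singleton_consistent (T : finType) (F : {set T})
    (ws : seq (weighing T)) (c : T) :
  discreet 1 F ws -> consistent F ws [set c].
Proof.
move=> /(_ c)[[S [consS /eqP/cards1P[x defS] cS]] _].
by move: cS consS; rewrite defS => /set1P ->.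
Qed.

Lemma discreet1_nil (T : finType) (F : {set T}) (ws : seq (weighing T)) :
  discreet 1 F ws -> ws = [::].
Proof.
case: ws => // w ws disc; exfalso.
apply: (@no_weighing_fits_all_singletons T w (outcome_of w F)) => c.
by case: (discreet_singleton_consistent _ _ _ c disc).
Qed.

Lemma exists_set_of_card (T : finType) (d : nat) :
  d <= #|T| -> exists S : {set T}, #|S| = d.
Proof.
move=> /card_geqP[s [uniq_s size_s _]].
by exists [set:: s]; rewrite cardsE (card_uniqP uniq_s).
Qed.

Theorem lemma1 (t d : nat) (T : finType) (cardT : #|T| = t)
    (t_gt1 : 1 < t) (d_le_t : d <= t) (d_neq1 : d <> 1) :
  ~ (exists (F : {set T}) (ws : seq (weighing T)),
       is_strategy 1 d F ws /\ discreet 1 F ws).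
Proof.
case=> F [ws [[_ not_d] /discreet1_nil ws0]]; apply: not_d.
have [|S cardS] := @exists_set_of_card T d; first by rewrite cardT.
by exists S; rewrite ws0.
Qed.
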